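(* Let $n_1\ge1$, $n_2\ge2$ be integers, $n=n_1+n_2$, $\mathrm{rk}=n_1+2$, and $r\in\mathbb{N}$. For the symmetric cone $\mathbb{E}_+=\mathbb{R}_+^{n_1}\times\mathbb{L}^{n_2}$, $$\mathcal{I}_{{\rm dP},r}^{n}(\mathbb{E}_+)=\bigcap_{\boldsymbol{\alpha}\in\mathbb{N}^{\mathrm{rk}},\ |\boldsymbol{\alpha}|=r+2}\left\{\boldsymbol{A}\in\mathbb{S}^n\ \middle|\ \text{there exists } t_{\boldsymbol{\alpha}}\in\mathbb{R}\text{ such that } \boldsymbol{M}(\boldsymbol{A},\boldsymbol{\alpha})-t_{\boldsymbol{\alpha}}\begin{pmatrix}1&\boldsymbol{0}\\\boldsymbol{0}&-\boldsymbol{I}_{n_2-1}\end{pmatrix}\in\mathbb{S}_+^{n_2}\right\}.$$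
   Context: $\mathbb{N}$ is the set of nonnegative integers, $\mathbb{S}^k$ (resp. $\mathbb{S}_+^k$) the set of real symmetric (resp. positive semidefinite) $k\times k$ matrices, $S^{k}$ the unit sphere in $\mathbb{R}^{k+1}$, $\mathbb{L}^{n_2}=\{(x_1,\boldsymbol{x}_{2:n_2})\in\mathbb{R}^{n_2}\mid x_1\ge\|\boldsymbol{x}_{2:n_2}\|_2\}$ the second-order cone, $|\boldsymbol{\alpha}|=\sum_i\alpha_i$. Definition of the left-hand side. $\mathcal{I}_{{\rm dP},r}^{\mathrm{rk}}$ is the set of $\boldsymbol{B}\in\mathbb{S}^{\mathrm{rk}}$ such that the polynomial $(x_1+\cdots+x_{\mathrm{rk}})^r\boldsymbol{x}^\top\boldsymbol{B}\boldsymbol{x}$ has only nonnegative coefficients. For $\boldsymbol{v}\in S^{n_2-2}$ let $c_i(\boldsymbol{v})=(\boldsymbol{e}_i,\boldsymbol{0}_{n_2})\in\mathbb{R}^n$ for $i=1,\dots,n_1$, $c_{n_1+1}(\boldsymbol{v})=(\boldsymbol{0}_{n_1},1/2,\boldsymbol{v}/2)$ and $c_{n_1+2}(\boldsymbol{v})=(\boldsymbol{0}_{n_1},1/2,-\boldsymbol{v}/2)$ (these are Jordan frames of the Euclidean Jordan algebra associated with $\mathbb{R}_+^{n_1}\times\mathbb{L}^{n_2}$, and they exhaust all its Jordan frames up to ordering). Then $\mathcal{I}_{{\rm dP},r}^{n}(\mathbb{E}_+)$ is the set of $\boldsymbol{A}\in\mathbb{S}^n$ such that for every $\boldsymbol{v}\in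 S^{n_2-2}$ the matrix $(c_i(\boldsymbol{v})^\top\boldsymbol{A}\,c_j(\boldsymbol{v}))_{i,j=1}^{\mathrm{rk}}$ belongs to $\mathcal{I}_{{\rm dP},r}^{\mathrm{rk}}$. Definition of $\boldsymbol{M}$. Partition $$\boldsymbol{A}=\begin{pmatrix}\boldsymbol{A}^{(11)}&\boldsymbol{A}^{(121)}&(\boldsymbol{A}^{(122)})^\top\\(\boldsymbol{A}^{(121)})^\top&A^{(2121)}&(\boldsymbol{A}^{(2122)})^\top\\\boldsymbol{A}^{(122)}&\boldsymbol{A}^{(2122)}&\boldsymbol{A}^{(2222)}\end{pmatrix}$$ with $\boldsymbol{A}^{(11)}\in\mathbb{S}^{n_1}$, $\boldsymbol{A}^{(121)}\in\mathbb{R}^{n_1}$, $\boldsymbol{A}^{(122)}\in\mathbb{R}^{(n_2-1)\times n_1}$, $A^{(2121)}\in\mathbb{R}$, $\boldsymbol{A}^{(2122)}\in\mathbb{R}^{n_2-1}$, $\boldsymbol{A}^{(2222)}\in\mathbb{S}^{n_2-1}$. For $\boldsymbol{\alpha}=(\boldsymbol{\alpha}_1,\alpha_{21},\alpha_{22})\in\mathbb{N}^{n_1}\times\mathbb{N}\times\mathbb{N}$ let $M^{(11)}=4\{\boldsymbol{\alpha}_1^\top\boldsymbol{A}^{(11)}\boldsymbol{\alpha}_1-\boldsymbol{\alpha}_1^\top\operatorname{diag}(\boldsymbol{A}^{(11)})\}+4(\alpha_{21}+\alpha_{22})\boldsymbol{\alpha}_1^\top\boldsymbol{A}^{(121)}+(\alpha_{21}+\alpha_{22})(\alpha_{21}+\alpha_{22}-1)A^{(2121)}$,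 $\boldsymbol{M}^{(21)}=2(\alpha_{21}-\alpha_{22})\boldsymbol{A}^{(122)}\boldsymbol{\alpha}_1+(\alpha_{21}-\alpha_{22})(\alpha_{21}+\alpha_{22}-1)\boldsymbol{A}^{(2122)}$, $\boldsymbol{M}^{(22)}=\{(\alpha_{21}-\alpha_{22})^2-(\alpha_{21}+\alpha_{22})\}\boldsymbol{A}^{(2222)}$, where $\operatorname{diag}(\cdot)$ is the vector of diagonal elements, and $$\boldsymbol{M}(\boldsymbol{A},\boldsymbol{\alpha})=\begin{pmatrix}M^{(11)}&(\boldsymbol{M}^{(21)})^\top\\\boldsymbol{M}^{(21)}&\boldsymbol{M}^{(22)}\end{pmatrix}\in\mathbb{S}^{n_2}.$$ *)

(* Defs.v *)
From mathcomp Require Import all_boot all_order all_algebra.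
From mathcomp Require Import classical_sets reals mpoly.

Set Implicit Arguments.
Unset Strict Implicit.
Unset Printing Implicit Defensive.

Import Order.TTheory GRing.Theory Num.Theory.
Local Open Scope classical_set_scope.
Local Open Scope ring_scope.

(* Throughout, m stands for n_2 - 1, so that R^n = R^(n_1 + n_2) is          *)
(* 'cV_(n1 + (1 + m)) and the three-by-three partition of a matrix A is the   *)
(* one given by the iterated block projections ulsubmx, ..., drsubmx.         *)
(* The rank n_1 + 2 splits as n1 + 2 through lshift / rshift.                 *)

Definition Sym (R : realType) (k : nat) : set 'M[R]_k := [set A | A^T = A].

Definition SymPsd (R : realType) (k : nat) : set 'M[R]_k :=
  [set A | Sym A /\ forall x : 'cV[R]_k, 0 <= (x^T *m A *m x) 0 0].

(* The Euclidean unit sphere of R^m (the norm `|v| of the libraries is the    *)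
(* max norm, hence the explicit sum of squares).                              *)
Definition unit_sphere (R : realType) (m : nat) : set 'cV[R]_m :=
  [set v | Num.sqrt (\sum_i v i 0 ^+ 2) = 1].

Definition quad_mpoly (R : realType) (k : nat) (B : 'M[R]_k) : {mpoly R[k]} :=
  \sum_i \sum_j B i j *: ('X_i * 'X_j).

Definition IdP (R : realType) (k r : nat) : set 'M[R]_k :=
  [set B | Sym B /\
     forall a : 'X_{1..k}, 0 <= ((\sum_i 'X_i) ^+ r * quad_mpoly B)@_a].

Definition jordan_frame (R : realType) (n1 m : nat) (v : 'cV[R]_m)
    (i : 'I_(n1 + 2)) : 'cV[R]_(n1 + (1 + m)) :=
  match split i with
  | inl j => col_mx (delta_mx j 0) 0
  | inr j => col_mx 0 (col_mx (2^-1)%:M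
                         (if j == 0 then 2^-1 *: v else - (2^-1 *: v)))
  end.

Definition IdP_cone (R : realType) (n1 m r : nat) :
    set 'M[R]_(n1 + (1 + m)) :=
  [set A | Sym A /\
     forall v : 'cV[R]_m, unit_sphere v ->
       IdP r (\matrix_(i < n1 + 2, j < n1 + 2)
                ((jordan_frame v i)^T *m A *m jordan_frame v j) 0 0)].

Section BlockMatrix.
Variables (R : realType) (n1 m : nat).
Variables (A : 'M[R]_(n1 + (1 + m))) (a : 'X_{1..n1 + 2}).

Let A11 : 'M[R]_n1 := ulsubmx A.
Let A121 : 'cV[R]_n1 := lsubmx (ursubmx A).
Let A122 : 'M[R]_(m, n1) := dsubmx (dlsubmx A).
Let A2121 : 'M[R]_1 := ulsubmx (drsubmx A).
Let A2122 : 'cV[R]_m := dlsubmx (drsubmx A).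
Let A2222 : 'M[R]_m := drsubmx (drsubmx A).

(* The exponents are cast into R before any subtraction takes place.          *)
Let a1 : 'cV[R]_n1 := \col_i (a (lshift 2 i))%:R.
Let a21 : R := (a (rshift n1 0))%:R.
Let a22 : R := (a (rshift n1 1))%:R.

Definition M11 : 'M[R]_1 :=
  4 *: (a1^T *m A11 *m a1 - a1^T *m (\col_i A11 i i))
  + (4 * (a21 + a22)) *: (a1^T *m A121)
  + ((a21 + a22) * (a21 + a22 - 1)) *: A2121.

Definition M21 : 'cV[R]_m :=
  (2 * (a21 - a22)) *: (A122 *m a1)
  + ((a21 - a22) * (a21 + a22 - 1)) *: A2122.

Definition M22 : 'M[R]_m :=
  ((a21 - a22) ^+ 2 - (a21 + a22)) *: A2222.

Definition Mmx : 'M[R]_(1 + m) := block_mx M11 M21^T M21 M22.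

End BlockMatrix.

(* Main.v *)
Require Import Defs.
From mathcomp Require Import all_boot all_order all_algebra.
From mathcomp Require Import classical_sets reals mpoly.
From mathcomp Require Import ring lra.

(** Up to the positive factor [r! / a!], the coefficient of [x^a], |a| = r + 2,
    in [(x_1 + ... + x_k)^r x^T B x] is [a^T B a - a^T diag(B)].  When [B] is the
    Gram matrix of the Jordan frame of [v], four times this number is
    [(1, v)^T M(A, a) (1, v)].  Hence the left-hand side says that each quadratic
    form [M(A, a)] is nonnegative on the vectors [(1, v)], [v] in the unit sphere,
    that is, by homogeneity, on the zero set of the Lorentz form
    [J = diag(1, -I)].  By the S-lemma with an equality constraint this holds iff
    [M(A, a) - t J] is positive semidefinite for some [t]. *)

Set Implicit Arguments.
Unset Strict Implicit.
Unset Printing Implicit Defensive.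

Import Order.TTheory GRing.Theory Num.Theory.
Local Open Scope classical_set_scope.
Local Open Scope ring_scope.

(** * Quadratic forms and the S-lemma with an equality constraint *)

Definition qform (R : pzRingType) (k : nat) (A : 'M[R]_k) (x : 'cV[R]_k) : R :=
  (x^T *m A *m x) 0 0.

Lemma qform_line (R : comPzRingType) (k : nat) (A : 'M[R]_k) (x y : 'cV[R]_k)
    (s : R) :
  qform A (x + s *: y) =
  qform A x + s * ((x^T *m A *m y) 0 0 + (y^T *m A *m x) 0 0)
  + s ^+ 2 * qform A y.
Proof.
have tr_line : (x + s *: y)^T = x^T + s *: y^T.
  by apply/matrixP => i j; rewrite !mxE.
rewrite /qform tr_line !mulmxDl !mulmxDr -!scalemxAl -!scalemxAr.
by rewrite !mxE; ring.
Qed.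

Lemma qform_linear_comb (R : comPzRingType) (k : nat) (A B : 'M[R]_k)
    (t : R) (x : 'cV[R]_k) :
  qform (A - t *: B) x = qform A x - t * qform B x.
Proof. by rewrite /qform mulmxBr mulmxBl -scalemxAr -scalemxAl !mxE. Qed.

(** The product [c / a] of the roots is negative. Concretely, [- 4 * a * c > 0] makes the root [d]
    of the discriminant exceed both [b] and [- b]. *)
Lemma quadratic_roots_opposite_sign (R : rcfType) (a b c : R) :
  0 < c -> a < 0 ->
  exists s1 s2 : R, [/\ s1 < 0, 0 < s2,
    c + s1 * b + s1 ^+ 2 * a = 0 & c + s2 * b + s2 ^+ 2 * a = 0].
Proof.
move=> c0 a0.
pose d := Num.sqrt (b ^+ 2 - 4 * a * c).
have d2 : d ^+ 2 = b ^+ 2 - 4 * a * c by rewrite sqr_sqrtr//; nra.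
have d0 : 0 <= d by exact: sqrtr_ge0.
have [db1 db2] : b < d /\ - b < d by split; nra.
have an0 : a != 0 by rewrite lt_eqF.
have aV : a^-1 < 0 by rewrite invr_lt0.
exists ((d - b) / (2 * a)), ((- d - b) / (2 * a)); split.
- by rewrite invfM; nra.
- by rewrite invfM; nra.
- have -> : c = (b ^+ 2 - d ^+ 2) / (4 * a) by rewrite d2; field.
  by field.
- have -> : c = (b ^+ 2 - d ^+ 2) / (4 * a) by rewrite d2; field.
  by field.
Qed.

(* On the line x + s y, A - (A(y)/J(y)) J is affine in s and nonnegative at
   the two zeros of J, which surround s = 0. *)
Lemma qform_ratio_le (R : rcfType) (k : nat) (A J : 'M[R]_k) (x y : 'cV[R]_k) :
  (forall z, qform J z = 0 -> 0 <= qform A z) ->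
  0 < qform J x -> qform J y < 0 ->
  qform A y / qform J y <= qform A x / qform J x.
Proof.
move=> AJ x0 y0.
have [s1 [s2 [s1n s2p r1 r2]]] :=
  quadratic_roots_opposite_sign
    ((x^T *m J *m y) 0 0 + (y^T *m J *m x) 0 0) x0 y0.
have /AJ := etrans (qform_line J x y s1) r1.
have /AJ := etrans (qform_line J x y s2) r2.
rewrite !qform_line ler_pdivlMr//.
move: r1 r2.
have yJ : qform A y = (qform A y / qform J y) * qform J y.
  by rewrite mulfVK ?lt_eqF.
set l := qform A y / qform J y in yJ *; rewrite yJ; clearbody l.
set b := (x^T *m J *m y) 0 0 + _; set c := (x^T *m A *m y) 0 0 + _.
move: (qform J x) (qform J y) (qform A x) => jx jy ax r1 r2 h2 h1.
have e1 : 0 <= ax - l * jx + s1 * (c - l * b).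
  have -> : ax - l * jx + s1 * (c - l * b) =
    ax + s1 * c + s1 ^+ 2 * (l * jy) - l * (jx + s1 * b + s1 ^+ 2 * jy) by ring.
  by rewrite r1 mulr0 subr0.
have e2 : 0 <= ax - l * jx + s2 * (c - l * b).
  have -> : ax - l * jx + s2 * (c - l * b) =
    ax + s2 * c + s2 ^+ 2 * (l * jy) - l * (jx + s2 * b + s2 ^+ 2 * jy) by ring.
  by rewrite r2 mulr0 subr0.
(* The affine function has slope [c - l * b]; its value at 0 is at least its value at [s1 < 0] if it
   increases, and at [s2 > 0] if it decreases. *)
by have [cb|cb] := leP 0 (c - l * b); nra.
Qed.

(** A suitable [t] must lie above all ratios A(y)/J(y) with J(y) < 0 and below all ratios A(x)/J(x)
    with J(x) > 0. By [qform_ratio_le] the supremum of the former does; [y0] makes their set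
    nonempty and [x0] makes it bounded. *)
Lemma S_lemma_equality (R : realType) (k : nat) (A J : 'M[R]_k) :
  (exists x, 0 < qform J x) -> (exists y, qform J y < 0) ->
  (forall z, qform J z = 0 -> 0 <= qform A z) ->
  exists t : R, forall x, 0 <= qform (A - t *: J) x.
Proof.
move=> [x0 x0J] [y0 y0J] AJ.
pose E := [set qform A y / qform J y | y in [set y | qform J y < 0]].
have ubE x : 0 < qform J x -> ubound E (qform A x / qform J x).
  by move=> xJ _ [y /= yJ <-]; exact: qform_ratio_le.
exists (sup E) => x; rewrite qform_linear_comb subr_ge0.
have [xJ|xJ|xJ] := ltgtP (qform J x) 0.
- rewrite -ler_ndivrMr//; apply: ub_le_sup; last by exists x.
  by exists (qform A x0 / qform J x0); exact: ubE.
- rewrite -ler_pdivlMr//; apply: ge_sup; last exact: ubE.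
  by exists (qform A y0 / qform J y0), y0.
- by rewrite xJ mulr0 AJ.
Qed.

(** * Coefficients of (x_1 + ... + x_k)^r x^T B x *)

Definition mnm_fact (k : nat) (a : 'X_{1..k}) : nat := (\prod_i (a i)`!)%N.

Lemma mnm_fact_gt0 (k : nat) (a : 'X_{1..k}) : (0 < mnm_fact a)%N.
Proof. by apply: prodn_gt0 => i; exact: fact_gt0. Qed.

Lemma mnm_factD1 (k : nat) (a : 'X_{1..k}) (i : 'I_k) :
  mnm_fact (a + U_(i)) = ((a i).+1 * mnm_fact a)%N.
Proof.
rewrite /mnm_fact (bigD1 i)//= [in RHS](bigD1 i)//= mulnA.
rewrite mnmDE mnm1E eqxx addn1 factS; congr (_ * _)%N.
by apply: eq_bigr => j ji; rewrite mnmDE mnm1E eq_sym (negbTE ji) addn0.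
Qed.

(** Since a! = a_i (a - e_i)!, weighting coefficients by a! keeps the recursion free of division.
    The truncation of [a - U_(i)] at [a i = 0] is harmless, because the factor [a i] vanishes
    there. *)
Lemma mcoeffMX_fact (R : nzRingType) (k : nat) (p : {mpoly R[k]})
    (a : 'X_{1..k}) (i : 'I_k) :
  (mnm_fact a)%:R * (p * 'X_i)@_a =
  (a i)%:R * ((mnm_fact (a - U_(i)))%:R * p@_(a - U_(i))).
Proof.
have [ai0|ai0] := eqVneq (a i) 0%N.
  rewrite ai0 mul0r memN_msupp_eq0 ?mulr0//; apply/negP.
  rewrite (perm_mem (msuppMX _ _)) => /mapP[b _ ab].
  by move: ai0; rewrite ab mnmDE mnm1E eqxx.
have Ua : (U_(i) <= a)%MM by rewrite lep1mP.
rewrite -{1 2}(submK Ua) mnm_factD1 [((a - _) + _)%MM]addmC mcoeffMX.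
by rewrite mnmBE mnm1E eqxx subn1 prednK ?lt0n// natrM mulrA.
Qed.

Lemma mdegB1_eq (k d : nat) (a : 'X_{1..k}) (i : 'I_k) :
  a i != 0%N -> (mdeg (a - U_(i)) == d) = (mdeg a == d.+1).
Proof.
by rewrite -lep1mP => Ua; rewrite -{2}(submK Ua) mdegD mdeg1 addn1 eqSS.
Qed.

Lemma mcoeff_sumX_exp (R : nzRingType) (k r : nat) (a : 'X_{1..k}) :
  (mnm_fact a)%:R * (((\sum_i 'X_i) ^+ r : {mpoly R[k]})@_a) =
  (r`! * (mdeg a == r))%:R.
Proof.
elim: r a => [|r IHr] a.
  rewrite expr0 mcoeff1 mdeg_eq0 mul1n; have [->|_] := eqVneq a 0%MM.
    by rewrite mulr1 /mnm_fact big1// => i _; rewrite mnm0E.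
  by rewrite mulr0.
rewrite exprSr mulr_sumr (raddf_sum (mcoeff a)) mulr_sumr.
under eq_bigr => i _ do rewrite mcoeffMX_fact IHr -natrM.
rewrite -natr_sum; congr (_%:R).
have step i : (a i * (r`! * (mdeg (a - U_(i)) == r)) =
               a i * (r`! * (mdeg a == r.+1)))%N.
  by have [->//|ai0] := eqVneq (a i) 0%N; rewrite mdegB1_eq.
under eq_bigr => i _ do rewrite step.
rewrite -big_distrl /= -mdegE factS.
by have [->|_] := eqVneq (mdeg a) r.+1; rewrite ?muln1 ?muln0.
Qed.

Definition multinomial_form (R : comNzRingType) (k : nat) (B : 'M[R]_k)
    (a : 'X_{1..k}) : R :=
  qform B (\col_i (a i)%:R) - \sum_i (a i)%:R * B i i.

(** The weights a_j (a_i - [i = j]) are those produced by removing x_j and then x_i from the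
    monomial x^a. *)
Lemma multinomial_formE (R : comNzRingType) (k : nat) (B : 'M[R]_k)
    (a : 'X_{1..k}) :
  multinomial_form B a =
  \sum_i \sum_j B i j * ((a j)%:R * ((a i)%:R - (i == j)%:R)).
Proof.
rewrite /multinomial_form /qform mxE.
under eq_bigr => j _ do rewrite mxE mulr_suml.
rewrite exchange_big -sumrB; apply: eq_bigr => i _.
rewrite [X in _ - X](_ : _ = \sum_j (i == j)%:R * ((a j)%:R * B i j)).
  by rewrite -sumrB; apply: eq_bigr => j _; rewrite !mxE; ring.
rewrite (bigD1 i)//= eqxx mul1r big1 ?addr0// => j ij.
by rewrite eq_sym (negbTE ij) mul0r.
Qed.

Lemma mcoeff_sumX_exp_quad (R : comNzRingType) (k r : nat) (B : 'M[R]_k)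
    (a : 'X_{1..k}) :
  (mnm_fact a)%:R * (((\sum_i 'X_i) ^+ r * \sum_i \sum_j B i j *: ('X_i * 'X_j)
     : {mpoly R[k]})@_a) =
  (r`! * (mdeg a == (r + 2)%N))%:R * multinomial_form B a.
Proof.
rewrite multinomial_formE mulr_sumr raddf_sum !mulr_sumr /=.
apply: eq_bigr => i _; rewrite mulr_sumr raddf_sum !mulr_sumr /=.
apply: eq_bigr => j _; rewrite -scalerAr mcoeffZ mulrCA [RHS]mulrCA.
congr (_ * _); rewrite mulrA mcoeffMX_fact mcoeffMX_fact mcoeff_sumX_exp.
have [->|aj0] := eqVneq (a j) 0%N; first by rewrite !mul0r mulr0.
(* As [a j] is nonzero, the truncated subtraction of exponents agrees with the one in [R], also when
   [i = j]. *)
have -> : (a i)%:R - (i == j)%:R = ((a - U_(j))%MM i)%:R :> R.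
  rewrite mnmBE mnm1E [j == i]eq_sym natrB//.
  by have [->|//] := eqVneq i j; rewrite lt0n.
have [->|bi0] := eqVneq ((a - U_(j))%MM i) 0%N; first by rewrite !mul0r !mulr0.
by rewrite !mdegB1_eq// addn2; ring.
Qed.

(** The factors a! and r! are positive, and the polynomial is homogeneous of degree r + 2, so all
    other coefficients vanish. *)
Lemma IdPP (R : realType) (k r : nat) (B : 'M[R]_k) :
  IdP r B <-> Sym B /\
    forall a : 'X_{1..k}, mdeg a = (r + 2)%N -> 0 <= multinomial_form B a.
Proof.
rewrite /IdP /quad_mpoly /=; split=> -[symB B0]; split=> // a.
  move=> ar; have := mcoeff_sumX_exp_quad r B a.
  rewrite ar eqxx muln1 => h.
  rewrite -(@pmulr_rge0 _ (r`!)%:R) ?ltr0n ?fact_gt0// -h.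
  by rewrite mulr_ge0// B0.
rewrite -(@pmulr_rge0 _ (mnm_fact a)%:R) ?ltr0n ?mnm_fact_gt0//.
rewrite mcoeff_sumX_exp_quad; have [/B0 ?|_] := eqVneq (mdeg a) (r + 2)%N.
  by rewrite mulr_ge0.
by rewrite muln0 mul0r.
Qed.

(** The Gram matrix is C^T A C, where C has the columns [c i], and its diagonal entries are the
    values of the form at these columns. *)
Lemma multinomial_form_gram (R : comNzRingType) (k n : nat) (A : 'M[R]_n)
    (c : 'I_k -> 'cV[R]_n) (a : 'X_{1..k}) :
  multinomial_form (\matrix_(i, j) ((c i)^T *m A *m c j) 0 0) a =
  qform A (\sum_i (a i)%:R *: c i) - \sum_i (a i)%:R * qform A (c i).
Proof.
rewrite /multinomial_form; congr (_ - _); last first.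
  by apply: eq_bigr => i _; rewrite mxE.
pose C : 'M[R]_(n, k) := \matrix_(p, i) c i p 0.
have -> : \sum_i (a i)%:R *: c i = C *m \col_i (a i)%:R.
  apply/colP => p; rewrite summxE mxE; apply: eq_bigr => i _.
  by rewrite !mxE mulrC.
have -> : \matrix_(i, j) ((c i)^T *m A *m c j) 0 0 = C^T *m A *m C.
  apply/matrixP => i j; rewrite !mxE; apply: eq_bigr => p _.
  by rewrite !mxE; congr (_ * _); apply: eq_bigr => l _; rewrite !mxE.
by rewrite /qform trmx_mul !mulmxA.
Qed.

(** * Quadratic forms of symmetric block matrices *)

Lemma tr_mx11E (R : pzRingType) (B : 'M[R]_1) : B^T 0 0 = B 0 0.
Proof. by rewrite mxE. Qed.

Lemma qform_sym_block (R : comNzRingType) (p q : nat) (P : 'M[R]_p)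
    (S : 'M[R]_(q, p)) (W : 'M[R]_q) (x : 'cV[R]_p) (z : 'cV[R]_q) :
  qform (block_mx P S^T S W) (col_mx x z) =
  qform P x + 2 * (z^T *m S *m x) 0 0 + qform W z.
Proof.
rewrite /qform tr_col_mx mul_row_block mul_row_col !mulmxDl.
have -> : x^T *m S^T *m z = (z^T *m S *m x)^T by rewrite !trmx_mul trmxK mulmxA.
by rewrite !mxE; ring.
Qed.

Lemma qform_scale (R : comNzRingType) (k : nat) (A : 'M[R]_k) (s : R)
    (x : 'cV[R]_k) :
  qform A (s *: x) = s ^+ 2 * qform A x.
Proof.
have := qform_line A 0 x s; rewrite add0r => ->.
by rewrite /qform !(mulmx0, trmx0, mul0mx) !mxE; ring.
Qed.

Lemma qform_scalel (R : comNzRingType) (k : nat) (A : 'M[R]_k) (s : R)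
    (x : 'cV[R]_k) :
  qform (s *: A) x = s * qform A x.
Proof. by rewrite /qform -scalemxAr -scalemxAl mxE. Qed.

Lemma qform0 (R : comNzRingType) (k : nat) (A : 'M[R]_k) : qform A 0 = 0.
Proof. by rewrite /qform mulmx0 mxE. Qed.

Lemma qform_mx11 (R : comNzRingType) (A : 'M[R]_1) (y : R) :
  qform A y%:M = y ^+ 2 * A 0 0.
Proof.
by rewrite /qform tr_scalar_mx mul_scalar_mx mul_mx_scalar !mxE expr2 mulrA.
Qed.

Lemma qform_delta (R : comNzRingType) (k : nat) (A : 'M[R]_k) (i : 'I_k) :
  qform A (delta_mx i 0) = A i i.
Proof. by rewrite /qform trmx_delta -rowE -colE !mxE. Qed.

(** This is the shape of a symmetric [A] in the partition that defines M, with [b] the transpose of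
    A121 and [S], [c], [u], [W] the blocks A122, A2121, A2122, A2222. *)
Lemma qform_sym_block3 (R : comNzRingType) (p q : nat) (P : 'M[R]_p)
    (b : 'rV[R]_p) (S : 'M[R]_(q, p)) (c : 'M[R]_1) (u : 'cV[R]_q)
    (W : 'M[R]_q) (x : 'cV[R]_p) (y : R) (z : 'cV[R]_q) :
  qform (block_mx P (col_mx b S)^T (col_mx b S) (block_mx c u^T u W))
    (col_mx x (col_mx y%:M z)) =
  qform P x + 2 * (y * (b *m x) 0 0 + (z^T *m S *m x) 0 0) +
  (y ^+ 2 * c 0 0 + 2 * (y * (z^T *m u) 0 0) + qform W z).
Proof.
rewrite !qform_sym_block qform_mx11 tr_col_mx tr_scalar_mx mul_row_col.
rewrite mul_scalar_mx mul_mx_scalar mulmxDl -scalemxAl.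
by congr (_ + 2 * _ + (_ + 2 * _ + _)); rewrite !mxE.
Qed.

Lemma Sym_block (R : realType) (p q : nat) (A : 'M[R]_(p + q)) :
  Sym A -> A = block_mx (ulsubmx A) (dlsubmx A)^T (dlsubmx A) (drsubmx A).
Proof. by rewrite /Sym /= => symA; rewrite trmx_dlsub symA submxK. Qed.

Lemma Sym_drsub (R : realType) (p q : nat) (A : 'M[R]_(p + q)) :
  Sym A -> Sym (drsubmx A).
Proof. by rewrite /Sym /= => symA; rewrite trmx_drsub symA. Qed.

(** * The Jordan frame of v and the matrix M *)

Lemma jordan_frame_lshift (R : realType) (n1 m : nat) (v : 'cV[R]_m)
    (j : 'I_n1) :
  jordan_frame v (lshift 2 j) = col_mx (delta_mx j 0) (col_mx 0%:M 0).
Proof.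
by rewrite /jordan_frame -[lshift 2 j]/(unsplit (inl j)) unsplitK raddf0 col_mx0.
Qed.

Lemma jordan_frame_rshift0 (R : realType) (n1 m : nat) (v : 'cV[R]_m) :
  jordan_frame v (rshift n1 0) = col_mx 0 (col_mx (2^-1)%:M (2^-1 *: v)).
Proof. by rewrite /jordan_frame -[rshift n1 0]/(unsplit (inr 0)) unsplitK. Qed.

Lemma jordan_frame_rshift1 (R : realType) (n1 m : nat) (v : 'cV[R]_m) :
  jordan_frame v (rshift n1 1) = col_mx 0 (col_mx (2^-1)%:M (- 2^-1 *: v)).
Proof.
by rewrite /jordan_frame -[rshift n1 1]/(unsplit (inr 1)) unsplitK scaleNr.
Qed.

Lemma sum_jordan_frame (R : realType) (n1 m : nat) (v : 'cV[R]_m)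
    (a : 'X_{1..n1 + 2}) :
  let a21 := (a (rshift n1 0))%:R in let a22 := (a (rshift n1 1))%:R in
  \sum_i (a i)%:R *: jordan_frame v i =
  col_mx (\col_i (a (lshift 2 i))%:R)
    (col_mx ((a21 + a22) / 2)%:M (((a21 - a22) / 2) *: v)).
Proof.
move=> a21 a22; rewrite big_split_ord /= !big_ord_recl big_ord0 addr0.
rewrite [lift ord0 ord0](_ : _ = 1); last exact: val_inj.
under eq_bigr => i _ do
  rewrite jordan_frame_lshift scale_col_mx raddf0 col_mx0 scaler0.
rewrite jordan_frame_rshift0 jordan_frame_rshift1 !scale_col_mx !scaler0.
rewrite !add_col_mx addr0.
have -> : \sum_(i < n1) col_mx ((a (lshift 2 i))%:R *: delta_mx i 0) 0 =
    col_mx (\col_i (a (lshift 2 i))%:R) (0 : 'cV[R]_(1 + m)).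
  apply/colP => i; rewrite summxE; case: (split_ordP i) => j ->.
    rewrite col_mxEu mxE (bigD1 j)//= col_mxEu !mxE !eqxx mulr1.
    rewrite big1 ?addr0// => l lj.
    by rewrite col_mxEu !mxE eq_sym (negbTE lj) mulr0.
  by rewrite col_mxEd mxE big1// => l _; rewrite col_mxEd mxE.
rewrite add_col_mx addr0 add0r; congr (col_mx _ (col_mx _ _)).
  by rewrite !scale_scalar_mx -raddfD /= mulrDl.
by rewrite !scalerA -scalerDl mulrN mulrBl.
Qed.

(** The factor 4 clears the halves in the last two frame elements. Subtracting the values at the
    frame elements yields the corrections in M: diag(A11), the [- 1] next to A2121 and A2122, and
    [- (a21 + a22)] next to A2222. *)
Lemma multinomial_form_jordan_frame (R : realType) (n1 m : nat)
    (A : 'M[R]_(n1 + (1 + m))) (v : 'cV[R]_m) (a : 'X_{1..n1 + 2}) :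
  Sym A ->
  4 * multinomial_form
    (\matrix_(i, j) ((jordan_frame v i)^T *m A *m jordan_frame v j) 0 0) a =
  qform (Mmx A a) (col_mx 1%:M v).
Proof.
move=> symA; rewrite multinomial_form_gram sum_jordan_frame.
rewrite [X in qform _ _ - X]big_split_ord /= !big_ord_recl big_ord0 addr0.
rewrite [lift ord0 ord0](_ : _ = 1); last exact: val_inj.
rewrite jordan_frame_rshift0 jordan_frame_rshift1.
rewrite /Mmx qform_sym_block /M11 /M21 /M22.
have symD : Sym (drsubmx A) by exact: Sym_drsub.
have -> : lsubmx (ursubmx A) = (usubmx (dlsubmx A))^T.
  by rewrite trmx_usub trmx_dlsub symA.
under eq_bigr => i _ do rewrite jordan_frame_lshift.
rewrite (Sym_block symA) (Sym_block symD) !block_mxKul !block_mxKdl !block_mxKdr.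
rewrite block_mxKdl.
rewrite block_mxKul.
rewrite -[dlsubmx A in LHS]vsubmxK.
(* By symmetry the lower blocks determine [A]; once generalized, they leave an identity between
   independent matrices. *)
move: (ulsubmx A) (usubmx (dlsubmx A)) (dsubmx (dlsubmx A)) => P b S.
move: (ulsubmx (drsubmx A)) (dlsubmx (drsubmx A)) (drsubmx (drsubmx A)).
move=> c u W.
rewrite [rshift n1 ord0](_ : _ = rshift n1 0)//.
set a21 := (a (rshift n1 0))%:R; set a22 := (a (rshift n1 1))%:R.
set x := \col_i _.
have -> : \sum_(i < n1) (a (lshift 2 i))%:R *
    qform (block_mx P (col_mx b S)^T (col_mx b S) (block_mx c u^T u W))
      (col_mx (delta_mx i 0) (col_mx 0%:M 0)) = (x^T *m \col_i P i i) 0 0.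
  rewrite mxE; apply: eq_bigr => i _.
  rewrite qform_sym_block3 qform_delta qform0 trmx0 !mul0mx !mxE.
  by rewrite expr0n /= !(mul0r, addr0, mulr0).
rewrite !qform_sym_block3 !qform_scale qform_scalel qform_mx11 !qform0.
rewrite !mulmx0 mulmx1 mulmxDr -!scalemxAr -!trmx_mul [(_ *: v)^T]linearZ.
rewrite ![(_ *: v)^T]linearZ /= -!scalemxAl mulmxA.
(* Passing to the entries of the 1 x 1 matrices leaves a scalar identity. *)
have addE (X Y : 'M[R]_1) : (X + Y) 0 0 = X 0 0 + Y 0 0 by rewrite mxE.
have oppE (X : 'M[R]_1) : (- X) 0 0 = - X 0 0 by rewrite mxE.
have scaleE (l : R) (X : 'M[R]_1) : (l *: X) 0 0 = l * X 0 0 by rewrite mxE.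
rewrite !(addE, oppE, scaleE) tr_mx11E [(0 : 'M_1) 0 0]mxE.
rewrite -[(x^T *m P *m x) 0 0]/(qform P x).
by field.
Qed.

(** * The Lorentz form and its zero set *)

Lemma qform_lorentz (R : comNzRingType) (m : nat) (y : R) (z : 'cV[R]_m) :
  qform (block_mx 1%:M 0 0 (- 1%:M)) (col_mx y%:M z) =
  y ^+ 2 - \sum_i z i 0 ^+ 2.
Proof.
rewrite -[X in block_mx _ X](trmx0 R m 1) qform_sym_block qform_mx11.
rewrite mulmx0 mul0mx !mxE /= mulr0 addr0 mulr1; congr (_ + _).
rewrite /qform mulmxN mulNmx mulmx1 !mxE; congr (- _).
by apply: eq_bigr => i _; rewrite mxE expr2.
Qed.

Lemma unit_sphereE (R : realType) (m : nat) (v : 'cV[R]_m) :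
  unit_sphere v <-> \sum_i v i 0 ^+ 2 = 1.
Proof.
rewrite /unit_sphere /=; split=> [v1|->]; last exact: sqrtr1.
by rewrite -[LHS]sqr_sqrtr ?v1 ?expr1n// sumr_ge0// => i _; exact: sqr_ge0.
Qed.

Lemma sum_sqr_eq0 (R : realDomainType) (m : nat) (z : 'cV[R]_m) :
  \sum_i z i 0 ^+ 2 = 0 -> z = 0.
Proof.
move/eqP; rewrite psumr_eq0 => [/allP z0|i _]; last exact: sqr_ge0.
apply/colP => i; rewrite mxE; apply/eqP.
by rewrite -(sqrf_eq0 (z i 0)); apply: z0; exact: mem_index_enum.
Qed.

(** The nonzero zeros of J are the multiples y (1, v) with v in the unit sphere, and the form scales
    by y^2, so the sign of y is immaterial. The bound on [m] provides a vector (0, e) where J is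
    negative. *)
Lemma lorentz_S_lemma (R : realType) (m : nat) (M : 'M[R]_(1 + m)) :
  (0 < m)%N ->
  (forall v, unit_sphere v -> 0 <= qform M (col_mx 1%:M v)) <->
  exists t : R, forall x,
    0 <= qform (M - t *: block_mx 1%:M 0 0 (- 1%:M)) x.
Proof.
move=> m0; split=> [M0|[t Mt] v /unit_sphereE v1]; last first.
  have := Mt (col_mx 1%:M v).
  by rewrite qform_linear_comb qform_lorentz v1 expr1n subrr mulr0 subr0.
apply: S_lemma_equality.
- exists (col_mx 1%:M 0); rewrite qform_lorentz big1 => [|i _].
    by rewrite expr1n subr0.
  by rewrite mxE expr0n.
- exists (col_mx 0%:M (delta_mx (Ordinal m0) 0)).
  rewrite qform_lorentz (bigD1 (Ordinal m0))//= big1 => [|i /negbTE i0].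
    by rewrite mxE !eqxx !expr0n/= expr1n addr0 sub0r oppr_lt0.
  by rewrite mxE i0 expr0n.
- move=> x; rewrite -(vsubmxK x) (mx11_scalar (usubmx x)).
  move: (usubmx x 0 0) (dsubmx x) => y z.
  rewrite qform_lorentz => /eqP; rewrite subr_eq0 => /eqP yz.
  have [y0|y0] := eqVneq y 0.
    have -> : z = 0 by apply: sum_sqr_eq0; rewrite -yz y0 expr0n.
    by rewrite y0 raddf0 col_mx0 qform0.
  have -> : col_mx y%:M z = y *: col_mx 1%:M (y^-1 *: z).
    by rewrite scale_col_mx scale_scalar_mx mulr1 scalerA divff// scale1r.
  rewrite qform_scale mulr_ge0 ?sqr_ge0//; apply/M0/unit_sphereE.
  under eq_bigr => i _ do rewrite mxE exprMn.
  by rewrite -mulr_sumr -yz exprVn mulVf// sqrf_eq0.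
Qed.

(** * Symmetry of the matrices and equality of the two sets *)

Lemma Sym_gram (R : realType) (k n : nat) (A : 'M[R]_n)
    (c : 'I_k -> 'cV[R]_n) :
  Sym A -> Sym (\matrix_(i, j) ((c i)^T *m A *m c j) 0 0).
Proof.
rewrite /Sym /= => symA; apply/matrixP => i j.
by rewrite [LHS]mxE [LHS]mxE [RHS]mxE -[LHS]tr_mx11E !trmx_mul symA trmxK mulmxA.
Qed.

Lemma Sym_Mmx (R : realType) (n1 m : nat) (A : 'M[R]_(n1 + (1 + m)))
    (a : 'X_{1..n1 + 2}) (t : R) :
  Sym A -> Sym (Mmx A a - t *: block_mx 1%:M 0 0 (- 1%:M)).
Proof.
move=> symA; have symD : Sym (drsubmx (drsubmx A)) by do 2 apply: Sym_drsub.
have trM : (Mmx A a)^T = Mmx A a.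
  rewrite /Mmx tr_block_mx trmxK; congr block_mx.
    by apply/matrixP => i j; rewrite mxE !ord1.
  by rewrite /M22 linearZ /= symD.
rewrite /Sym /= raddfB /= trM linearZ /= tr_block_mx !trmx0 raddfN /=.
by rewrite !tr_scalar_mx.
Qed.

Theorem mainTheorem6 (R : realType) (n1 n2 r : nat)
    (hn1 : (1 <= n1)%N) (hn2 : (2 <= n2)%N) :
  @IdP_cone R n1 n2.-1 r =
  \bigcap_(a in [set a : 'X_{1..n1 + 2} | mdeg a = (r + 2)%N])
    [set A : 'M[R]_(n1 + (1 + n2.-1)) |
       Sym A /\
       exists t : R,
         SymPsd (Mmx A a - t *: block_mx 1%:M 0 0 (- 1%:M))].
Proof.
have m0 : (0 < n2.-1)%N by rewrite -subn1 subn_gt0.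
apply/seteqP; split=> A.
  move=> [symA A0] a /= ar; split=> //.
  have /(lorentz_S_lemma _ m0)[t Mt] : forall v, unit_sphere v ->
      0 <= qform (Mmx A a) (col_mx 1%:M v).
    move=> v v1; rewrite -multinomial_form_jordan_frame// mulr_ge0//.
    by have /IdPP[_] := A0 v v1; exact.
  by exists t; split; [exact: Sym_Mmx|exact: Mt].
move=> A0.
have symA : Sym A.
  (* Symmetry of [A] is stated inside the intersection, so some index of degree r + 2 has to be
     exhibited. *)
  have [|//] := A0 (U_(rshift n1 0%R) *+ (r + 2))%MM.
  by rewrite /= mdegMn mdeg1 mul1n.
split=> // v v1; apply/IdPP; split; first exact: Sym_gram.
move=> a /A0[_ [t [_ Mt]]].
rewrite -(@pmulr_rge0 _ 4)// multinomial_form_jordan_frame//.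
by apply: (proj2 (lorentz_S_lemma _ m0)) v1; exists t.
Qed.
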